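(* Let $N$ be a positive integer and let $\Lambda=\{\lambda_1,\dots,\lambda_N\}$ be a set of $N$ distinct positive real numbers, labelled so that $0<\lambda_1<\lambda_2<\dots<\lambda_N$. Assume $\mathcal{T}_\Lambda^{\geq}\neq\emptyset$. Then the image of $\mathcal{T}_\Lambda^{\geq}$ under the linearization map $\Phi:\mathcal{T}_\Lambda\to\mathrm{Jac}(X)$ is $$\Phi(\mathcal{T}_\Lambda^{\geq})=\left\{[F_1:F_2:\dots:F_N]\in\mathrm{Jac}(X)\ \middle|\ (-1)^iF_i>0\ \text{for all } i\right\},$$ where a class belongs to the right-hand side if it has a representative $(F_1,\dots,F_N)$ with real entries satisfying $(-1)^iF_i>0$ for all $i=1,\dots,N$.
   Context: $E$ is the identity matrix. $\Gamma$ is the set of tridiagonal matrices $L\in M_N(\mathbb{C})$ with diagonal entries $a_1,\dots,a_N\in\mathbb{C}$, all superdiagonal entries (positions $(i,i+1)$) equal to $1$, subdiagonal entries $b_1,\dots,b_{N-1}\in\mathbb{C}$ (with $b_i$ in position $(i+1,i)$) satisfying $b_1b_2\cdots b_{N-1}\neq 0$, and all other entries $0$. The isospectral set $\mathcal{T}_\Lambda$ is the set of all $L\in\Gamma$ with $\det(\lambda E-L)=\prod_{i=1}^N(\lambda-\lambda_i)$. A real matrix is totally nonnegative if all its minors are nonnegative, and $\mathcal{T}_\Lambda^{\geq}$ is the set of totally nonnegative matrices in $\mathcal{T}_\Lambda$. $X$ is the reduced nodal curve obtained from two copies $X_-,X_+$ of $\mathbb{P}^1(\mathbb{C})$, with coordinates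 $x$ and $y$, by gluing transversally the point $x=\lambda_i$ of $X_-$ to the point $y=\lambda_i$ of $X_+$ for $i=1,\dots,N$. Its generalized Jacobi variety is defined as $\mathrm{Jac}(X):=\mathcal{O}^\times/\mathbb{C}^\times$, where $\mathcal{O}=\mathbb{C}[\lambda]/(\prod_i(\lambda-\lambda_i))$. By evaluation $\varphi\mapsto(\varphi(\lambda_1),\dots,\varphi(\lambda_N))$, it is identified with $(\mathbb{C}^\times)^N/\mathbb{C}^\times$ (quotient by the diagonal), whose elements are written $[F_1:\dots:F_N]$. The linearization map is $\Phi(L):=[\Delta_{1,1}(\lambda_1):\Delta_{1,1}(\lambda_2):\dots:\Delta_{1,1}(\lambda_N)]$, where $\Delta_{1,1}(\lambda)$ is the determinant of the matrix obtained from $L-\lambda E$ by deleting its first row and first column (for $N=1$ it is $1$). For $L\in\mathcal{T}_\Lambda$ all the values $\Delta_{1,1}(\lambda_i)$ are nonzero. *)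

(* Defs.v *)
From HB Require Import structures.
From mathcomp Require Import all_boot all_order all_algebra.
From mathcomp Require Export complex.
From mathcomp Require Import boolp classical_sets reals.

Set Implicit Arguments.
Unset Strict Implicit.
Unset Printing Implicit Defensive.

Import Order.TTheory GRing.Theory Num.Theory.
Local Open Scope ring_scope.
Local Open Scope complex_scope.
Local Open Scope quotient_scope.

(* The size N >= 1 is n.+1 and all indices are 0-based: lambda_1, ..., lambda_N
   are lam ord0, ..., lam ord_max, so the sign (-1)^i of the i-th coordinate
   reads (-1) ^+ i.+1. *)

Section TotalNonnegativity.

Variables (R : realType) (m : nat).

Definition totally_nonneg (M : 'M[R]_m) : Prop :=
  forall (k : nat) (f g : 'I_k -> 'I_m),
    (forall i j : 'I_k, (i < j)%N -> (f i < f j)%N) ->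
    (forall i j : 'I_k, (i < j)%N -> (g i < g j)%N) ->
    0 <= \det (mxsub f g M).

End TotalNonnegativity.

Section Tridiagonal.

Variables (K : fieldType) (n : nat).

Definition tridiagonal_shape (L : 'M[K]_n.+1) : Prop :=
  (forall i j : 'I_n.+1, nat_of_ord j = i.+1 -> L i j = 1)
  /\ (forall i j : 'I_n.+1, (i.+1 < j)%N \/ (j.+1 < i)%N -> L i j = 0).

(* lift ord0 k and widen_ord _ k have values k.+1 and k. *)
Definition subdiag (L : 'M[K]_n.+1) (k : 'I_n) : K :=
  L (lift ord0 k) (widen_ord (leqnSn n) k).

Definition in_Gamma (L : 'M[K]_n.+1) : Prop :=
  tridiagonal_shape L /\ \prod_(k < n) subdiag L k != 0.

Definition Delta11 (L : 'M[K]_n.+1) (x : K) : K :=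
  \det (row' ord0 (col' ord0 (L - x%:M))).

End Tridiagonal.

Section Minor.

Variable K : fieldType.

Lemma det_tridiag n (A : 'M[K]_n.+2) :
  (forall i j : 'I_n.+2, (i.+1 < j)%N \/ (j.+1 < i)%N -> A i j = 0) ->
  let D := row' ord0 (col' ord0 A) in
  \det A = A ord0 ord0 * \det D
    - A ord0 (lift ord0 ord0) * A (lift ord0 ord0) ord0
      * \det (row' ord0 (col' ord0 D)).
Proof.
move=> A0 D; rewrite (expand_det_row _ ord0) big_ord_recl; congr (_ + _).
  by rewrite /cofactor /= expr0 mul1r.
rewrite big_ord_recl big1 => [|i _]; last by rewrite A0 ?mul0r//; left.
rewrite addr0 /cofactor /= -mulrA -mulrN; congr (_ * _).
rewrite (expand_det_col _ ord0) big_ord_recl big1 => [|i _]; last first.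
  by rewrite !mxE A0 ?mul0r//; right.
rewrite addr0 /cofactor /= expr0 mul1r expr1 mulN1r; congr (- (_ * _)).
  by rewrite !mxE; congr (A _ _); apply/val_inj.
congr (\det _); apply/matrixP => i j; rewrite !mxE.
by congr (A _ _); apply/val_inj.
Qed.

Lemma minor_neq0 n (A : 'M[K]_n.+1) :
  (forall i j : 'I_n.+1, (i.+1 < j)%N \/ (j.+1 < i)%N -> A i j = 0) ->
  (forall i j : 'I_n.+1, nat_of_ord j = i.+1 -> A i j != 0) ->
  (forall i j : 'I_n.+1, nat_of_ord i = j.+1 -> A i j != 0) ->
  \det A = 0 -> \det (row' ord0 (col' ord0 A)) != 0.
Proof.
elim: n A => [|n IH] A A0 Au Al dA; first by rewrite det_mx00 oner_neq0.
apply/eqP => dD; have := det_tridiag A0; rewrite /= dA dD mulr0 sub0r.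
move/esym/eqP; rewrite oppr_eq0 !mulf_eq0 (negbTE (Au _ _ _))//=.
rewrite (negbTE (Al _ _ _))//=; apply/negP; apply: IH => // i j.
- by move=> ij; rewrite !mxE A0// /= /bump /=.
- by move=> ij; rewrite !mxE Au// /= /bump /= ij.
- by move=> ij; rewrite !mxE Al// /= /bump /= ij.
Qed.

End Minor.

Section Isospectral.

Variables (R : realType) (n : nat) (lam : 'I_n.+1 -> R).

Definition spec_poly : {poly R[i]} :=
  \prod_(i < n.+1) ('X - (lam i)%:C%:P).

(* char_poly L is \det ('X%:M - map_mx polyC L). *)
Definition isospectral : Type :=
  {L : 'M[R[i]]_n.+1 | in_Gamma L /\ char_poly L = spec_poly}.

Definition tnn_isospectral : set isospectral :=
  [set L | exists2 M : 'M[R]_n.+1,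
     sval L = map_mx (fun x : R => x%:C) M & totally_nonneg M].

Lemma Delta11_neq0 (L : isospectral) (i : 'I_n.+1) :
  Delta11 (sval L) (lam i)%:C != 0.
Proof.
case: L => L /= [[[L1 L0] Lb] charL].
have offE (j k : 'I_n.+1) : nat_of_ord j <> k ->
    (L - (lam i)%:C%:M) j k = L j k.
  move=> jk; rewrite !mxE; case: eqVneq => [e|_]; last by rewrite subr0.
  by case: jk; rewrite e.
apply: minor_neq0 => [j k jk|j k jk|j k jk|].
- rewrite offE ?L0// => e; move: jk; rewrite e.
  by rewrite ltnNge leqnSn; case.
- by rewrite offE ?L1 ?oner_neq0// jk; apply/n_Sn.
- rewrite offE ?jk; last by move/esym/n_Sn.
  have kn : (k < n)%N by rewrite -ltnS -jk.
  move/prodf_neq0: Lb => /(_ (Ordinal kn) isT); rewrite /subdiag.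
  by congr (L _ _ != 0); apply/val_inj.
- apply/eqP/det0P; have : root (char_poly L) (lam i)%:C.
    rewrite charL /root /spec_poly horner_prod (bigD1 i)//=.
    by rewrite hornerXsubC subrr mul0r.
  rewrite -eigenvalue_root_char => /eigenvalueP [v vL v0]; exists v => //.
  by rewrite mulmxBr vL mul_mx_scalar subrr.
Qed.

End Isospectral.

Arguments tnn_isospectral {R n} lam.

Section Jacobian.

Variables (R : realType) (n : nat) (lam : 'I_n.+1 -> R).

(* {poly %/ p} is C[X]/(p) only for p monic of positive degree, which holds
   here by mk_spec_poly below. *)
Definition cO : Type := {poly %/ spec_poly lam}.

Definition evO (u : cO) (i : 'I_n.+1) : R[i] := (u : {poly R[i]}).[(lam i)%:C].

Definition cO_units : Type := {u : cO | u \is a GRing.unit}.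

Definition jac_rel (u v : cO_units) : bool :=
  `[< exists2 c : R[i], c != 0 & val u = c *: val v >].

Lemma jac_rel_refl : reflexive jac_rel.
Proof. by move=> u; apply/asboolP; exists 1; rewrite ?oner_neq0 ?scale1r. Qed.

Lemma jac_rel_sym : symmetric jac_rel.
Proof.
move=> u v; apply/asboolP/asboolP => -[c c0 ->]; exists c^-1;
  by rewrite ?invr_eq0// scalerA mulVf// scale1r.
Qed.

Lemma jac_rel_trans : transitive jac_rel.
Proof.
move=> v u w /asboolP[c c0 uv] /asboolP[d d0 vw]; apply/asboolP.
by exists (c * d); rewrite ?mulf_neq0// uv vw scalerA.
Qed.

Canonical jac_equiv := EquivRel jac_rel jac_rel_refl jac_rel_sym jac_rel_trans.

Definition Jac : Type := {eq_quot jac_equiv}.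

(* The Lagrange interpolant of F at the points lam i. *)
Definition interp_poly (F : 'I_n.+1 -> R[i]) : {poly R[i]} :=
  \sum_i F i *: \prod_(j | j != i)
     (((lam i)%:C - (lam j)%:C)^-1 *: ('X - (lam j)%:C%:P)).

Definition interp (F : 'I_n.+1 -> R[i]) : cO :=
  in_qpoly (spec_poly lam) (interp_poly F).

Hypothesis lam_inj : injective lam.

Lemma size_spec_poly : size (spec_poly lam) = n.+2.
Proof.
by rewrite /spec_poly size_prod_XsubC /index_enum -enumT size_enum_ord.
Qed.

Lemma mk_spec_poly : mk_monic (spec_poly lam) = spec_poly lam.
Proof. by rewrite /mk_monic size_spec_poly monic_prod_XsubC. Qed.

Lemma root_spec_poly i : (spec_poly lam).[(lam i)%:C] = 0.
Proof. by rewrite horner_prod (bigD1 i)//= hornerXsubC subrr mul0r. Qed.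

Lemma evO_in_qpoly (p : {poly R[i]}) i :
  evO (in_qpoly (spec_poly lam) p) i = p.[(lam i)%:C].
Proof.
rewrite /evO /= mk_spec_poly -Pdiv.IdomainMonic.modpE ?monic_prod_XsubC//.
rewrite [in RHS](divp_eq p (spec_poly lam)) !hornerE root_spec_poly.
by rewrite mulr0 add0r.
Qed.

Lemma evO_interp F i : evO (interp F) i = F i.
Proof.
rewrite evO_in_qpoly horner_sum (bigD1 i)//= [X in _ + X]big1 => [|j ji].
  rewrite addr0 hornerZ horner_prod big1 ?mulr1// => j ji.
  rewrite hornerZ hornerXsubC mulVf// -rmorphB/= fmorph_eq0 subr_eq0.
  by rewrite inj_eq// eq_sym.
rewrite hornerZ horner_prod (bigD1 i) 1?eq_sym//= hornerZ hornerXsubC.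
by rewrite subrr mulr0 mul0r mulr0.
Qed.

Lemma evO_inj (u v : cO) : evO u =1 evO v -> u = v.
Proof.
move=> uv; apply/val_inj/eqP; rewrite -subr_eq0; apply/eqP.
pose s := [seq (lam i)%:C | i <- enum 'I_n.+1].
apply: (@roots_geq_poly_eq0 _ _ s).
- apply/allP => _ /mapP[i _ ->]; rewrite rootE hornerD hornerN subr_eq0.
  exact/eqP/uv.
- rewrite map_inj_uniq ?enum_uniq// => i j /complexI; exact: lam_inj.
- rewrite size_map size_enum_ord (leq_trans (size_polyD _ _))//.
  have sz (w : cO) : (size (val w) <= n.+1)%N.
    rewrite -ltnS -size_spec_poly.
    by apply: leq_trans (size_mk_monic w) _; rewrite mk_spec_poly.
  by rewrite size_polyN geq_max !sz.
Qed.

Lemma evO_unit (u : cO) :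
  (u \is a GRing.unit) = [forall i, evO u i != 0].
Proof.
have [p -> evE] : exists2 p : {poly R[i]},
    (u \is a GRing.unit) = coprimep (mk_monic (spec_poly lam)) p
    & forall i, evO u i = p.[(lam i)%:C] by exists (u : {poly R[i]}).
rewrite mk_spec_poly coprimep_sym /spec_poly -big_enum/=.
have -> : [forall i, evO u i != 0] = all (fun i => evO u i != 0) (enum 'I_n.+1).
  by apply/forallP/allP => h i; [move=> _ | apply: h; exact: mem_enum].
elim: (enum _) => [|i s IH] /=; first by rewrite big_nil coprimep1.
by rewrite big_cons coprimepMr IH coprimep_XsubC rootE evE.
Qed.

Lemma interp_unit F : (forall i, F i != 0) -> interp F \is a GRing.unit.
Proof. by move=> F0; rewrite evO_unit; apply/forallP => i; rewrite evO_interp. Qed.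

(* The class [F_1 : ... : F_N] of the unit of cO with values F_i at lambda_i.
   By jac_class_eq and jac_class_surj, this identifies Jac with
   (C^x)^N / C^x. *)
Definition jac_class (F : 'I_n.+1 -> R[i]) (F0 : forall i, F i != 0) : Jac :=
  \pi_Jac (exist _ (interp F) (interp_unit F0) : cO_units).

Lemma jac_class_eq F F0 G G0 :
  @jac_class F F0 = @jac_class G G0 <->
  exists2 c : R[i], c != 0 & forall i, F i = c * G i.
Proof.
have evZ c (u : cO) i : evO (c *: u) i = c * evO u i by rewrite /evO hornerZ.
split=> [/eqquotP/asboolP[c c0 /= FG]|[c c0 FG]].
  by exists c => // i; rewrite -(evO_interp F) FG evZ evO_interp.
apply/eqquotP/asboolP; exists c => //=; apply: evO_inj => i.
by rewrite evZ !evO_interp.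
Qed.

Lemma jac_class_surj (J : Jac) : exists F F0, J = @jac_class F F0.
Proof.
have [u ->] : exists u, J = \pi_Jac u by exists (repr J); rewrite reprK.
have u0 i : evO (val u) i != 0.
  by have := valP u; rewrite evO_unit => /forallP.
exists (evO (val u)), u0; apply/eqquotP/asboolP; exists 1; rewrite ?oner_neq0//.
by rewrite scale1r /=; apply: evO_inj => i; rewrite evO_interp.
Qed.

Definition Phi (L : isospectral lam) : Jac :=
  @jac_class (fun i => Delta11 (sval L) (lam i)%:C) (Delta11_neq0 L).

End Jacobian.

Lemma incr_inj (R : realType) n (lam : 'I_n -> R) :
  (forall i j : 'I_n, (i < j)%N -> lam i < lam j) -> injective lam.
Proof.
move=> lt_lam i j e; apply/val_inj => /=.
by case: (ltngtP i j) => // /lt_lam; rewrite e ltxx.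
Qed.

(* Main.v *)
(* A matrix of Gamma with positive subdiagonal is a Jacobi matrix; let P be its
   characteristic polynomial and Q the one of its trailing principal block.  The
   Wronskian P' Q - P Q' is positive (Christoffel-Darboux), so Q has the sign
   of P' at every eigenvalue, which is the sign pattern of Delta11.
   Conversely, values with this pattern are interpolated by a polynomial Q of
   degree N - 1 whose roots interlace the eigenvalues.  The Euclidean algorithm
   on (P, Q) then yields a Jacobi matrix with positive subdiagonal all of whose
   trailing blocks have positive spectrum; the ratios of consecutive trailing
   determinants are the pivots of a UL factorization, and their positivity
   gives total nonnegativity. *)

Require Import Defs.
From mathcomp Require Import all_boot all_order all_algebra.
From mathcomp Require Import complex boolp classical_sets reals.
From mathcomp Require Import polyrcf ring zify.

Set Implicit Arguments.
Unset Strict Implicit.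
Unset Printing Implicit Defensive.

Import Order.TTheory GRing.Theory Num.Theory.
Local Open Scope ring_scope.
Local Open Scope complex_scope.
Local Open Scope classical_set_scope.

(** * Determinant expansions along a sparse first row or column *)

Section DetExpansion.

Variable K : comNzRingType.

Lemma det_first_row n (A : 'M[K]_n.+1) :
  (forall j, j != ord0 -> A ord0 j = 0) ->
  \det A = A ord0 ord0 * \det (row' ord0 (col' ord0 A)).
Proof.
move=> A0; rewrite (expand_det_row _ ord0) (bigD1 ord0)//= big1 => [|j j0].
  by rewrite addr0 /cofactor /= expr0 mul1r.
by rewrite A0 ?mul0r.
Qed.

Lemma det_first_col n (A : 'M[K]_n.+1) :
  (forall i, i != ord0 -> A i ord0 = 0) ->
  \det A = A ord0 ord0 * \det (row' ord0 (col' ord0 A)).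
Proof.
move=> A0; rewrite -det_tr det_first_row => [|j j0]; last by rewrite mxE A0.
rewrite mxE -[in RHS]det_tr; congr (_ * \det _).
by apply/matrixP => i j; rewrite !mxE.
Qed.

(** Only the first row and column are constrained: a minor of a tridiagonal matrix need not be
    tridiagonal further down. The ring is not assumed to be a field, so that characteristic matrices
    are covered. *)
Lemma det_tridiag_corner n (A : 'M[K]_n.+2) :
  (forall j : 'I_n.+2, (1 < j)%N -> A ord0 j = 0) ->
  (forall i : 'I_n.+2, (1 < i)%N -> A i ord0 = 0) ->
  let D := row' ord0 (col' ord0 A) in
  \det A = A ord0 ord0 * \det D
    - A ord0 (lift ord0 ord0) * A (lift ord0 ord0) ord0
      * \det (row' ord0 (col' ord0 D)).
Proof.
move=> Ar Ac D; rewrite (expand_det_row _ ord0) big_ord_recl; congr (_ + _).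
  by rewrite /cofactor /= expr0 mul1r.
rewrite big_ord_recl big1 => [|i _]; last by rewrite Ar ?mul0r.
rewrite addr0 /cofactor /= -mulrA -mulrN; congr (_ * _).
rewrite det_first_col => [|i i0]; last first.
  rewrite !mxE (_ : lift (lift ord0 ord0 : 'I_n.+2) (ord0 : 'I_n.+1) = ord0).
    by rewrite Ac// /= /bump /= ltnS lt0n.
  exact/val_inj.
rewrite expr1 mulN1r; congr (- (_ * _)).
  by rewrite !mxE; congr (A _ _); apply/val_inj.
congr (\det _); apply/matrixP => i j; rewrite !mxE.
by congr (A _ _); apply/val_inj.
Qed.

End DetExpansion.

(** * Jacobi matrices: recurrence, Wronskian and total nonnegativity *)

Section Jacobi.

Variable R : realType.
Implicit Types a b u : nat -> R.

(** The coefficients are sequences on [nat], so that passing to a trailing block is a mere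
    [shift]. *)
Definition jacobi a b n : 'M[R]_n :=
  \matrix_(i < n, j < n)
    if i == j :> nat then a i
    else if j == i.+1 :> nat then 1
    else if i == j.+1 :> nat then b j else 0.

Definition shift a : nat -> R := fun k => a k.+1.

Lemma jacobi_minor a b n :
  row' ord0 (col' ord0 (jacobi a b n.+1)) = jacobi (shift a) (shift b) n.
Proof. by apply/matrixP => i j; rewrite !mxE/= /bump/= !add1n !eqSS. Qed.

Lemma jacobi_far a b n (i j : 'I_n) :
  (i.+1 < j)%N \/ (j.+1 < i)%N -> jacobi a b n i j = 0.
Proof.
move=> ij; rewrite mxE.
by case: ltngtP; case: ij => ij; rewrite ?ifN//; lia.
Qed.

Lemma jacobi_diag a b n (i j : 'I_n) : i = j -> jacobi a b n i j = a i.
Proof. by move=> ->; rewrite mxE eqxx. Qed.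

Lemma jacobi_sup a b n (i j : 'I_n) :
  nat_of_ord j = i.+1 -> jacobi a b n i j = 1.
Proof. by move=> ij; rewrite mxE ij eqxx ltn_eqF. Qed.

Lemma jacobi_sub a b n (i j : 'I_n) :
  nat_of_ord i = j.+1 -> jacobi a b n i j = b j.
Proof. by move=> ij; rewrite mxE ij eqxx gtn_eqF// ltn_eqF// leqW. Qed.

Lemma jacobi_shape a b n : tridiagonal_shape (jacobi a b n.+1).
Proof. by split=> i j; [exact: jacobi_sup | exact: jacobi_far]. Qed.

Lemma subdiag_jacobi a b n k : subdiag (jacobi a b n.+1) k = b k.
Proof. by rewrite /subdiag jacobi_sub. Qed.

Lemma tridiagonal_jacobi n (M : 'M[R]_n.+1) : tridiagonal_shape M ->
  M = jacobi (fun k => M (inord k) (inord k))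
             (fun k => M (inord k.+1) (inord k)) n.+1.
Proof.
move=> [M1 M0]; apply/matrixP => i j; rewrite mxE.
case: eqVneq => [/val_inj<-|ij]; first by rewrite inord_val.
case: eqVneq => [ji|ji]; first by rewrite M1.
case: eqVneq => [ij1|ij1]; first by rewrite -ij1 !inord_val.
apply: M0; move: ij ji ij1.
by case: (ltngtP i j) => //= ij _ ji ij1; [left|right];
  rewrite ltn_neqAle ij eq_sym ?ij1 ?ji.
Qed.

Lemma char_poly_row'_col' n (M : 'M[R]_n.+1) :
  row' ord0 (col' ord0 (char_poly_mx M)) =
  char_poly_mx (row' ord0 (col' ord0 M)).
Proof. by apply/matrixP => i j; rewrite !mxE (inj_eq lift_inj). Qed.

Lemma char_poly_jacobi1 a b : char_poly (jacobi a b 1) = 'X - (a 0)%:P.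
Proof. by rewrite /char_poly det_mx11 !mxE. Qed.

Lemma char_poly_jacobi a b n :
  char_poly (jacobi a b n.+2) =
  ('X - (a 0)%:P) * char_poly (jacobi (shift a) (shift b) n.+1)
  - (b 0)%:P * char_poly (jacobi (shift (shift a)) (shift (shift b)) n).
Proof.
rewrite {1}/char_poly det_tridiag_corner.
- rewrite !char_poly_row'_col' !jacobi_minor !mxE/=.
  by rewrite mulr0n !sub0r mulrNN mul1r.
- by move=> [[|[|j]]] //= jn _; rewrite !mxE/= subrr.
- by move=> [[|[|j]]] //= jn _; rewrite !mxE/= subrr.
Qed.

(* Christoffel-Darboux: the Wronskian satisfies [W = Q ^+ 2 + b 0 * W'], where
   [W'] is the Wronskian of the trailing block. *)
Lemma char_poly_jacobi_wronskian a b n x :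
  (forall k, (k < n)%N -> 0 < b k) ->
  0 < ((char_poly (jacobi a b n.+1))^`()
         * char_poly (jacobi (shift a) (shift b) n)
       - char_poly (jacobi a b n.+1)
         * (char_poly (jacobi (shift a) (shift b) n))^`()).[x].
Proof.
elim: n a b => [|n IH] a b b0; set P := char_poly _; set Q := char_poly _.
  rewrite /P /Q char_poly_jacobi1 /char_poly det_mx00.
  by rewrite !derivE !hornerE !subr0 ltr01.
have W := IH (shift a) (shift b) (fun k kn => b0 k.+1 kn).
move: W; rewrite -/Q; set S := char_poly _ => W.
have -> : P^`() * Q - P * Q^`() = Q ^+ 2 + (b 0)%:P * (Q^`() * S - Q * S^`()).
  by rewrite /P char_poly_jacobi -/Q -/S !derivE; ring.
rewrite hornerD mul_polyC hornerZ horner_exp.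
by rewrite ltr_wpDl ?sqr_ge0// mulr_gt0// b0.
Qed.

(* The condition on [u] says that [jacobi a b] factors as an upper bidiagonal
   matrix with diagonal [u] times a lower unit bidiagonal one. *)
Lemma jacobi_tnn a b u m :
  (forall k, 0 < u k) -> (forall k, 0 <= b k) ->
  (forall k, a k = u k + b k / u k.+1) ->
  totally_nonneg (jacobi a b m).
Proof.
move=> u0 b0 aE; set J := jacobi a b m.
have J0 i j : 0 <= J i j.
  rewrite mxE; case: ifP => _.
    by rewrite aE addr_ge0 ?divr_ge0 ?(ltW (u0 _)).
  by do 2![case: ifP => //].
(* The lower bound by [u] is what absorbs the negative term of the three-term
   expansion of a minor whose corner is tridiagonal. *)
suff minor_ge k (f g : 'I_k.+1 -> 'I_m) :
    (forall i j : 'I_k.+1, (i < j)%N -> (f i < f j)%N) ->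
    (forall i j : 'I_k.+1, (i < j)%N -> (g i < g j)%N) ->
    0 <= \det (mxsub f g J) /\
    (f ord0 = g ord0 -> u (f ord0) *
       \det (mxsub (f \o lift ord0) (g \o lift ord0) J) <= \det (mxsub f g J)).
  by move=> [|k] f g fi gi; [rewrite det_mx00 | have [] := minor_ge k f g fi gi].
elim: k f g => [|k IH] f g fi gi.
  rewrite det_mx11 mxE det_mx00 J0; split=> // fg.
  by rewrite mulr1 fg mxE eqxx aE lerDl divr_ge0// ltW.
set A := mxsub f g J; set f' := f \o _; set g' := g \o _.
have liftE (h : 'I_k.+2 -> 'I_m) :
    (forall i j : 'I_k.+2, (i < j)%N -> (h i < h j)%N) ->
    forall i j : 'I_k.+1, (i < j)%N ->
      ((h \o lift ord0) i < (h \o lift ord0) j)%N.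
  by move=> hi i j ij; apply: hi; rewrite /= ltnS.
have [D0 Du] := IH f' g' (liftE f fi) (liftE g gi).
have AD : row' ord0 (col' ord0 A) = mxsub f' g' J.
  by apply/matrixP => i j; rewrite !mxE.
move: D0 Du; rewrite -AD; set D := row' _ _ => D0 Du.
have Jfar (i j : 'I_m) : (i.+1 < j)%N \/ (j.+1 < i)%N -> J i j = 0.
  exact: jacobi_far.
have mono_lift (h : 'I_k.+2 -> 'I_m) (i : 'I_k.+2) :
    (forall i j : 'I_k.+2, (i < j)%N -> (h i < h j)%N) ->
    i != ord0 -> (h (lift ord0 ord0) <= h i)%N.
  move=> hi; case: (unliftP ord0 i) => [j ->|->//] _.
  by have [->//|j0] := eqVneq j ord0; rewrite ltnW// hi//= ltnS lt0n.
have f01 : (f ord0 < f (lift ord0 ord0))%N by apply: fi.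
have g01 : (g ord0 < g (lift ord0 ord0))%N by apply: gi.
(* If the first indices differ, all other entries of the first row, or of the first column, lie at
   distance at least two from the diagonal and vanish. *)
have [fg|gf|/val_inj fg] := ltngtP (f ord0) (g ord0).
- split=> [|e]; last by move: fg; rewrite e ltnn.
  rewrite det_first_row ?mulr_ge0// 1?mxE// => j j0; rewrite mxE Jfar//; left.
  by rewrite (leq_trans _ (mono_lift _ _ gi j0))// (leq_trans _ g01).
- split=> [|e]; last by move: gf; rewrite e ltnn.
  rewrite det_first_col ?mulr_ge0// 1?mxE// => j j0; rewrite mxE Jfar//; right.
  by rewrite (leq_trans _ (mono_lift _ _ fi j0))// (leq_trans _ f01).
have A00 : A ord0 ord0 = a (f ord0) by rewrite mxE jacobi_diag.
suff Ale : u (f ord0) * \det D <= \det A.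
  by split=> //; apply: le_trans Ale; rewrite mulr_ge0// ltW.
have ua i : u i <= a i by rewrite aE lerDl divr_ge0// ltW.
have [f1|f1] := ltnP (f ord0).+1 (f (lift ord0 ord0)).
  rewrite (@det_first_col _ _ A) ?A00 ?ler_wpM2r// => i i0.
  rewrite mxE Jfar//; right; rewrite -fg.
  exact: leq_trans (mono_lift _ _ fi i0).
have [g1|g1] := ltnP (g ord0).+1 (g (lift ord0 ord0)).
  rewrite (@det_first_row _ _ A) ?A00 ?ler_wpM2r// => i i0.
  rewrite mxE Jfar//; left; rewrite fg.
  exact: leq_trans (mono_lift _ _ gi i0).
have {}f1 : f (lift ord0 ord0) = (f ord0).+1 :> nat.
  by apply/eqP; rewrite eqn_leq f1.
have {}g1 : g (lift ord0 ord0) = (g ord0).+1 :> nat.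
  by apply/eqP; rewrite eqn_leq g1.
rewrite (@det_tridiag_corner _ _ A) => [|j j1|j j1]; last 2 first.
- by rewrite mxE Jfar//; left; rewrite fg -g1; exact: gi.
- by rewrite mxE Jfar//; right; rewrite -fg -f1; exact: fi.
rewrite -/D A00 [A ord0 (lift _ _)]mxE jacobi_sup ?g1 ?fg//.
rewrite [A (lift _ _) ord0]mxE jacobi_sub ?f1 ?fg// mul1r.
have {Du} Du : u (f ord0).+1 * \det (row' ord0 (col' ord0 D)) <= \det D.
  rewrite -f1 (_ : row' ord0 _ = mxsub (f' \o lift ord0) (g' \o lift ord0) J).
    by apply: Du; apply/val_inj; rewrite /= f1 g1 fg.
  by apply/matrixP => i j; rewrite !mxE.
(* With [a = u + b / u'], where [u'] is the next pivot, the claim reduces to [Du] divided by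
   [u']. *)
rewrite aE mulrDl -[leRHS]addrA lerDl subr_ge0 -mulrA ler_wpM2l//.
by rewrite ler_pdivlMl -?fg.
Qed.



End Jacobi.

(** * Interlacing polynomials and the inverse spectral problem *)

Section Interlacing.

Variable R : realType.
Implicit Types (l mu : nat -> R) (q t : {poly R}).

Definition node_poly l n : {poly R} := \prod_(j < n) ('X - (l j)%:P).

Lemma node_polyS l n :
  node_poly l n.+1 = node_poly l n * ('X - (l n)%:P).
Proof. by rewrite /node_poly big_ord_recr. Qed.

Lemma size_node_poly l n : size (node_poly l n) = n.+1.
Proof.
by rewrite /node_poly size_prod_XsubC /index_enum -enumT size_enum_ord.
Qed.

Lemma node_poly_monic l n : node_poly l n \is monic.
Proof. exact: monic_prod_XsubC. Qed.

Lemma node_poly_root l n i : (i < n)%N -> (node_poly l n).[l i] = 0.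
Proof.
move=> iN; rewrite horner_prod (bigD1 (Ordinal iN))//= hornerXsubC.
by rewrite subrr mul0r.
Qed.

(** Each of the [n - k] nodes above [x] contributes one negative factor. *)
Lemma node_poly_sign l n k x : (k <= n)%N ->
  (forall j, (j < k)%N -> l j < x) ->
  (forall j, (k <= j < n)%N -> x < l j) ->
  0 < (-1) ^+ (n - k) * (node_poly l n).[x].
Proof.
elim: n k => [|n IH] k kn lx xl.
  by rewrite sub0n /node_poly big_ord0 hornerC mulr1 ltr01.
rewrite node_polyS hornerM hornerXsubC.
move: kn; rewrite leq_eqVlt => /orP[/eqP kn|kn].
  rewrite {}kn in lx *; rewrite subnn mul1r mulr_gt0 ?subr_gt0 ?lx//.
  have := IH n (leqnn n); rewrite subnn mul1r; apply=> j jn.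
    by rewrite lx// ltnW.
  by case/andP: jn => nj /(leq_ltn_trans nj); rewrite ltnn.
rewrite subSn// exprS mulN1r mulNr mulrA -mulrN mulr_gt0//; last first.
  by rewrite oppr_gt0 subr_lt0 xl// ltnSn andbT.
by apply: IH => // j /andP[kj jn]; rewrite xl// kj ltnW.
Qed.

(** The intermediate value theorem gives a root in each of the [n] gaps, and the bound on the degree
    leaves room for no other. *)
Lemma alternating_roots n l t :
  (forall i j, (i < j <= n)%N -> l i < l j) -> (size t <= n.+1)%N ->
  (forall i, (i <= n)%N -> 0 < (-1) ^+ (n - i) * t.[l i]) ->
  exists c mu, [/\ 0 < c, forall i, (i < n)%N -> l i < mu i < l i.+1
    & t = c *: node_poly mu n].
Proof.
move=> l_incr szt alt.
have /choice[mu muP] i : exists m, (i < n)%N ->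
    l i < m < l i.+1 /\ root t m.
  have [iN|_] := ltnP i n; last by exists 0.
  have [||m] := @poly_ivtoo _ t (l i) (l i.+1).
  - by rewrite ltW// l_incr// ltnSn.
  - have := mulr_gt0 (alt i (ltnW iN)) (alt _ iN).
    rewrite -(subnSK iN) exprS mulN1r mulrACA mulNr -expr2 sqrr_sign mulN1r.
    by rewrite oppr_gt0.
  - by rewrite in_itv/= => mi rm; exists m.
have mu_incr i j : (i < j < n)%N -> mu i < mu j.
  move=> /andP[ij jn]; have [/andP[_ mi] _] := muP i (ltn_trans ij jn).
  have [/andP[mj _] _] := muP j jn.
  apply: lt_trans mj; apply: lt_le_trans mi _.
  move: ij; rewrite leq_eqVlt => /predU1P[->//|ij].
  by rewrite ltW// l_incr// ij ltnW.
pose rs := mkseq mu n.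
have urs : uniq rs.
  apply/mkseq_uniqP => i j; rewrite !inE => iN jN.
  case: (ltngtP i j) => // ij e; [have := mu_incr i j | have := mu_incr j i];
    by rewrite ij ?iN ?jN e ltxx => /(_ isT).
have root_rs : all (root t) rs.
  by apply/allP => _ /mapP[k + ->]; rewrite mem_iota => /muP[].
have t0 : t != 0.
  by apply/eqP => t0; have := alt n (leqnn n); rewrite t0 horner0 mulr0 ltxx.
have sz : size t = (size rs).+1.
  apply/eqP; rewrite eqn_leq (max_poly_roots t0 root_rs urs) andbT.
  by rewrite size_mkseq.
have tE : t = lead_coef t *: node_poly mu n.
  rewrite {1}(all_roots_prod_XsubC sz root_rs) ?uniq_rootsE//; congr (_ *: _).
  rewrite /node_poly -(big_mkord xpredT (fun j => 'X - (mu j)%:P)).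
  by rewrite /index_iota subn0 big_map.
(* All the roots lie below [l n], so the leading coefficient has the sign of [t.[l n]]. *)
have node_gt0 : 0 < (node_poly mu n).[l n].
  have := @node_poly_sign mu n n (l n) (leqnn n); rewrite subnn mul1r; apply=> j.
    move=> jn; have [/andP[_ mj] _] := muP j jn; apply: lt_le_trans mj _.
    move: jn; rewrite leq_eqVlt => /predU1P[->//|jn].
    by rewrite ltW// l_incr// jn leqnn.
  by case/andP=> nj /(leq_ltn_trans nj); rewrite ltnn.
exists (lead_coef t), mu; split=> // [|i /muP[]//].
rewrite -(pmulr_lgt0 _ node_gt0) -hornerZ -tE.
by have := alt n (leqnn n); rewrite subnn mul1r.
Qed.

(** Newton interpolation: a multiple of [node_poly l n] corrects the value at the new node without
    changing the earlier ones. *)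
Lemma interpolation n l (y : nat -> R) :
  (forall i j, (i < j < n)%N -> l i < l j) ->
  exists2 t : {poly R}, (size t <= n)%N & forall i, (i < n)%N -> t.[l i] = y i.
Proof.
elim: n => [|n IH] l_incr; first by exists 0; rewrite ?size_poly0.
have [i j /andP[ij jn]|t szt tE] := IH; first by rewrite l_incr// ij ltnW.
have pn : (node_poly l n).[l n] != 0.
  rewrite horner_prod; apply/prodf_neq0 => i _.
  by rewrite hornerXsubC subr_eq0 gt_eqF// l_incr// ltn_ord/=.
exists (t + ((y n - t.[l n]) / (node_poly l n).[l n]) *: node_poly l n).
  rewrite (leq_trans (size_polyD _ _))// geq_max (leq_trans szt)//=.
  by rewrite (leq_trans (size_scale_leq _ _))// size_node_poly.
move=> i; rewrite ltnS leq_eqVlt => /predU1P[->|iN]; rewrite hornerD hornerZ.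
  by rewrite divfK// addrC subrK.
by rewrite (node_poly_root l iN) mulr0 addr0 tE.
Qed.

Lemma monic_size2E (d : {poly R}) :
  d \is monic -> size d = 2%N -> d = 'X - (- d`_0)%:P.
Proof.
move=> /monicP; rewrite /lead_coef => d1 sz; rewrite sz /= in d1.
apply/polyP => -[|[|i]]; rewrite coefB coefX coefC/= ?opprK ?sub0r ?subr0//.
  by rewrite add0r.
by rewrite oppr0 nth_default ?sz.
Qed.

(* One step of the Euclidean algorithm splits off the first row and column of
   the Jacobi matrix; the remainder alternates on the roots of [q], so the
   recursion applies to the pair ([q], remainder). *)
Lemma jacobi_inverse n l q :
  0 < l 0 -> (forall i j, (i < j <= n)%N -> l i < l j) ->
  q \is monic -> size q = n.+1 ->
  (forall i, (i <= n)%N -> 0 < (-1) ^+ (n - i) * q.[l i]) ->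
  exists a b u, [/\ forall k, 0 < u k, forall k, 0 <= b k,
      forall k, (k < n)%N -> 0 < b k & forall k, a k = u k + b k / u k.+1] /\
    [/\ char_poly (jacobi a b n.+1) = node_poly l n.+1,
        char_poly (jacobi (shift a) (shift b) n) = q
      & u 0 * q.[0] = - (node_poly l n.+1).[0]].
Proof.
elim: n l q => [|n IH] l q l0 l_incr qmon szq alt.
  have q1 : q = 1.
    have := size1_polyC (eq_leq szq) => qC; move/monicP: qmon.
    by rewrite qC lead_coefC => ->.
  exists (fun=> l 0), (fun=> 0), (fun=> l 0); split.
    by split=> // k; rewrite mul0r addr0.
  rewrite char_poly_jacobi1 /char_poly det_mx00 q1 /node_poly big_ord1.
  by rewrite !hornerE; split=> //; ring.
have [c [mu [c0 mu_btw qE]]] := alternating_roots l_incr (eq_leq szq) alt.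
have c1 : c = 1.
  move/monicP: qmon; rewrite qE lead_coefZ (monicP (node_poly_monic _ _)).
  by rewrite mulr1.
move: qE; rewrite c1 scale1r => qE {c c0 c1}.
have mu_incr i j : (i < j <= n)%N -> mu i < mu j.
  move=> /andP[ij jn].
  have /andP[_ mi] := mu_btw i (leqW (leq_trans ij jn)).
  have /andP[mj _] := mu_btw j jn.
  apply: lt_trans mj; apply: lt_le_trans mi _.
  move: ij; rewrite leq_eqVlt => /predU1P[->//|ij]; rewrite ltW// l_incr// ij.
  exact: leqW.
have l_le0 j : (j <= n.+1)%N -> 0 < l j.
  by case: j => // j jn; rewrite (lt_trans l0)// l_incr.
have mu0 j : (j <= n)%N -> 0 < mu j.
  by move=> jn; have /andP[+ _] := mu_btw j jn; apply: lt_trans; exact/l_le0/leqW.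
set p := node_poly l n.+2.
have q0 : q != 0 by rewrite monic_neq0.
have := divp_eq p q; set d := p %/ q; set s := p %% q => pE.
have szs : (size s <= n.+1)%N by rewrite -ltnS -szq ltn_modp.
have szd : size d = 2%N by rewrite /d size_divp// szq size_node_poly; lia.
have dmon : d \is monic.
  have := monicP (node_poly_monic l n.+2); rewrite -/p pE lead_coefDl.
    by rewrite lead_coefM (monicP qmon) mulr1 => /eqP.
  have d0 : d != 0 by rewrite -size_poly_gt0 szd.
  by rewrite size_Mmonic// szd szq addSn add1n /= ltnS leqW.
have sE i : (i <= n)%N -> s.[mu i] = p.[mu i].
  move=> iN; rewrite pE hornerD hornerM qE node_poly_root// mulr0 add0r.
  by [].
(* At a root of [q] the remainder [s] equals [p]; since [n.+1 - i] of the nodes of [p] lie above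
   [mu i], it is [- s] that has the required signs. *)
have sN_alt i : (i <= n)%N -> 0 < (-1) ^+ (n - i) * (- s).[mu i].
  move=> iN; rewrite hornerN sE//.
  have /andP[lm ml] := mu_btw i iN.
  have := @node_poly_sign l n.+2 i.+1 (mu i); rewrite subSS subSn// exprS.
  rewrite mulN1r mulNr mulrN; apply=> [||j /andP[ij jn]]; first exact: leqW.
    move=> j; rewrite ltnS leq_eqVlt => /predU1P[->//|ji].
    by rewrite (lt_trans _ lm)// l_incr// ji leqW.
  apply: lt_le_trans ml _; move: ij; rewrite leq_eqVlt => /predU1P[->//|ij].
  by rewrite ltW// l_incr// ij.
have [|c [nu [c0 _ sNE]]] := alternating_roots mu_incr _ sN_alt.
  by rewrite size_polyN.
have {}sE : s = - (c *: node_poly nu n) by rewrite -sNE opprK.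
have [||||i iN|a [b [u [[u0 b0 b1 aE] [Pq Pr ur]]]]] := IH mu (node_poly nu n).
- exact: mu0.
- exact: mu_incr.
- exact: node_poly_monic.
- exact: size_node_poly.
- by rewrite -(pmulr_rgt0 _ c0) mulrCA -hornerZ -sNE sN_alt.
(* All roots of [p] and [q] are positive, so their values at 0 have opposite signs; this makes the
   new pivot positive. *)
have p0 : 0 < (-1) ^+ n.+2 * p.[0].
  by apply: (@node_poly_sign l n.+2 0 0) => // j /andP[_ jn]; exact: l_le0.
have pq0 : 0 < (-1) ^+ n.+1 * q.[0].
  rewrite qE.
  by apply: (@node_poly_sign mu n.+1 0 0) => // j /andP[_ jn]; exact: mu0.
have q00 : q.[0] != 0.
  by apply/eqP => e; move: pq0; rewrite e mulr0 ltxx.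
have pE0 : p.[0] = d`_0 * q.[0] - c * (node_poly nu n).[0].
  by rewrite pE {1}(monic_size2E dmon szd) sE !hornerE opprK.
pose cons x (f : nat -> R) k := if k is k'.+1 then f k' else x.
(* The division reads [p = ('X - a 0) * q - b 0 * r] with [r] monic, which is the three-term
   recurrence. The pivot [- p.[0] / q.[0]] is the ratio of the determinants of the full matrix and
   of its trailing block. *)
exists (cons (- d`_0) a), (cons c b), (cons (- p.[0] / q.[0]) u); split.
  split.
  - case=> //=; rewrite -(pmulr_rgt0 _ pq0).
    suff -> : (-1) ^+ n.+1 * q.[0] * (- p.[0] / q.[0])
              = (-1) ^+ n.+2 * p.[0] by [].
    by rewrite [in RHS]exprS; field.
  - by case=> //=; exact: ltW.
  - by case.
  (* For the new index, the pivot relation is the recurrence at 0 divided by [q.[0]]. *)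
  - case=> [|k] //=; rewrite pE0; move: ur; rewrite -/(node_poly _ _) -qE => ur.
    have r0 : (node_poly nu n).[0] = - q.[0] / u 0.
      by rewrite -ur mulrC mulKf// gt_eqF.
    by rewrite r0; field; rewrite q00 gt_eqF.
split=> //=.
- rewrite char_poly_jacobi -[shift (cons _ a)]/a -[shift (cons _ b)]/b Pq Pr.
  by rewrite -qE -/p pE sE {2}(monic_size2E dmon szd) mul_polyC.
- by rewrite -[shift (cons _ a)]/a -[shift (cons _ b)]/b Pq.
- by rewrite mulfVK.
Qed.

End Interlacing.

(** * Descent from complex to real matrices, and the signs of [Delta11] *)

Section Spectrum.

Variables (R : realType) (n : nat) (lam : 'I_n.+1 -> R).
Implicit Types M : 'M[R]_n.+1.

Let l k := lam (inord k).

(** [Delta11] uses [M - x] and [char_poly] uses [x - M]; the block has size [n], whence the sign. *)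
Lemma Delta11_char_poly M x :
  Delta11 M x = (-1) ^+ n * (char_poly (row' ord0 (col' ord0 M))).[x].
Proof.
rewrite /Delta11 /char_poly -horner_evalE -det_map_mx -detZ; congr (\det _).
apply/matrixP => i j; rewrite !mxE (inj_eq lift_inj) /= /horner_eval.
by rewrite hornerD hornerN hornerC hornerMn hornerX mulN1r opprB.
Qed.

Lemma Delta11_complex M x :
  Delta11 (map_mx (real_complex R) M) x%:C = (Delta11 M x)%:C.
Proof.
rewrite /Delta11 -(det_map_mx (real_complex R)); congr (\det _).
by apply/matrixP => i j; rewrite !mxE rmorphB rmorphMn.
Qed.

Lemma spec_poly_node :
  spec_poly lam = map_poly (real_complex R) (node_poly l n.+1).
Proof.
rewrite /node_poly rmorph_prod; apply: eq_bigr => i _.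
by rewrite /= map_polyXsubC /l inord_val.
Qed.

Lemma char_poly_complex M :
  char_poly (map_mx (real_complex R) M) = spec_poly lam <->
  char_poly M = node_poly l n.+1.
Proof.
rewrite -map_char_poly spec_poly_node.
by split=> [/map_poly_inj|->].
Qed.

Lemma in_Gamma_complex M :
  in_Gamma (map_mx (real_complex R) M) <-> in_Gamma M.
Proof.
rewrite /in_Gamma /tridiagonal_shape.
have -> : \prod_k subdiag (map_mx (real_complex R) M) k =
    (\prod_k subdiag M k)%:C.
  by rewrite rmorph_prod; apply: eq_bigr => k _; rewrite /subdiag mxE.
rewrite fmorph_eq0; split=> -[[M1 M0] Mb]; split=> //; split=> i j ij.
- move: (M1 i j ij); rewrite mxE => MC.
  by apply: (@complexI R); rewrite MC rmorph1.
- move: (M0 i j ij); rewrite mxE => MC.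
  by apply: (@complexI R); rewrite MC rmorph0.
- by rewrite mxE M1.
- by rewrite mxE M0.
Qed.

Hypothesis lam_incr : forall i j : 'I_n.+1, (i < j)%N -> lam i < lam j.

Lemma nodes_incr i j : (i < j <= n)%N -> l i < l j.
Proof. by move=> /andP[ij jn]; apply: lam_incr; rewrite !inordK; lia. Qed.

(** At a simple root the derivative is the product over the other nodes, enumerated by [bump i];
    [n - i] of them lie above [l i]. *)
Lemma node_poly_deriv_sign i : (i <= n)%N ->
  0 < (-1) ^+ (n - i) * ((node_poly l n.+1)^`()).[l i].
Proof.
move=> iN; pose m k := l (bump i k).
have -> : node_poly l n.+1 = ('X - (l i)%:P) * node_poly m n.
  rewrite /node_poly (bigD1_ord (Ordinal (iN : (i < n.+1)%N)))//.
rewrite derivM hornerD !hornerM hornerXsubC subrr mul0r addr0 derivXsubC hornerC.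
rewrite mul1r; apply: node_poly_sign => // j.
- by move=> ji; apply: nodes_incr; rewrite /bump; lia.
- by move=> /andP[ij jn]; apply: nodes_incr; rewrite /bump; lia.
Qed.

(** Minors of order 1 and the condition of [in_Gamma] make the subdiagonal positive. At an
    eigenvalue the Wronskian then reduces to [P' * Q], so [Q] has the sign of [P']. *)
Lemma tnn_Delta11_sign M (i : 'I_n.+1) :
  in_Gamma M -> totally_nonneg M -> char_poly M = node_poly l n.+1 ->
  0 < (-1) ^+ i * Delta11 M (lam i).
Proof.
move=> [Mshape Mb] Mtnn charM.
move: (tridiagonal_jacobi Mshape).
set a := (X in jacobi X); set b := (X in jacobi _ X) => ME.
have b_gt0 k : (k < n)%N -> 0 < b k.
  move=> kn; rewrite lt_def; apply/andP; split.
    move/prodf_neq0: Mb => /(_ (Ordinal kn) isT).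
    by rewrite ME subdiag_jacobi.
  pose f (_ : 'I_1) : 'I_n.+1 := inord k.+1.
  pose g (_ : 'I_1) : 'I_n.+1 := inord k.
  have := Mtnn 1%N f g; rewrite det_mx11 mxE; apply.
    by move=> s t; rewrite !ord1.
  by move=> s t; rewrite !ord1.
have := char_poly_jacobi_wronskian a (l i) b_gt0.
rewrite -ME charM -jacobi_minor -ME hornerD hornerN !hornerM node_poly_root//.
rewrite mul0r subr0 => W.
have iN : (i <= n)%N by rewrite -ltnS.
have li : l i = lam i by rewrite /l inord_val.
rewrite Delta11_char_poly -li mulrA -exprD.
have := node_poly_deriv_sign iN.
set P := _.[_] in W *; set Q := _.[_] in W * => S.
(* The two exponents add up to [n + n], so the product is [P * Q]. *)
have : 0 < ((-1) ^+ (n - i) * P) * ((-1) ^+ (i + n) * Q).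
  rewrite mulrACA -exprD (_ : (n - i + (i + n) = n + n)%N); last by lia.
  by rewrite exprD -expr2 sqrr_sign mul1r.
by rewrite pmulr_rgt0.
Qed.

End Spectrum.

Theorem theorem1p1 (R : realType) (n : nat) (lam : 'I_n.+1 -> R)
    (lam_gt0 : forall i : 'I_n.+1, 0 < lam i)
    (lam_incr : forall i j : 'I_n.+1, (i < j)%N -> lam i < lam j) :
  tnn_isospectral lam !=set0 ->
  Phi (incr_inj lam_incr) @` tnn_isospectral lam =
  [set J : Jac lam |
    exists (F : 'I_n.+1 -> R[i]) (F0 : forall i : 'I_n.+1, F i != 0),
      J = jac_class (incr_inj lam_incr) F0 /\
      exists x : 'I_n.+1 -> R,
        (forall i : 'I_n.+1, F i = (x i)%:C) /\
        (forall i : 'I_n.+1, 0 < (-1) ^+ i.+1 * x i)].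
Proof.
move=> _; apply/seteqP; split=> [_ [[L /= [GL charL]] [M /= LM Mtnn] <-]|].
  have D_sign (i : 'I_n.+1) : 0 < (-1) ^+ i * Delta11 M (lam i).
    move: GL charL; rewrite LM => /in_Gamma_complex GM /char_poly_complex charM.
    exact: tnn_Delta11_sign.
  (* Indices start at 0, so [Delta11] has the opposite signs; negating it does not change the
     class. *)
  pose x i := - Delta11 M (lam i).
  have x_sign (i : 'I_n.+1) : 0 < (-1) ^+ i.+1 * x i.
    by rewrite /x exprS mulN1r mulrNN.
  have F0 i : (x i)%:C != 0.
    rewrite fmorph_eq0; apply/eqP => e; have := x_sign i.
    by rewrite e mulr0 ltxx.
  exists (fun i => (x i)%:C), F0; split; last by exists x.
  apply/jac_class_eq; exists (-1) => [|i /=].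
    by rewrite oppr_eq0 oner_neq0.
  by rewrite LM Delta11_complex /x rmorphN mulN1r opprK.
move=> _ [F [F0 [-> [x [Fx x_sign]]]]].
pose l k := lam (inord k).
(* This global sign makes the value at the largest node positive, as [alternating_roots]
   requires. *)
pose y k := (-1) ^+ n.+1 * x (inord k).
have y_sign i : (i <= n)%N -> 0 < (-1) ^+ (n - i) * y i.
  move=> iN; rewrite /y mulrA -exprD.
  have -> : (n - i + n.+1 = i.+1 + 2 * (n - i))%N by lia.
  rewrite exprD exprM sqrrN !expr1n mulr1.
  by have := x_sign (inord i); rewrite inordK.
have l_incr i j : (i < j < n.+1)%N -> l i < l j by exact: nodes_incr.
have [t szt tE] := interpolation y l_incr.
have t_sign i : (i <= n)%N -> 0 < (-1) ^+ (n - i) * t.[l i].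
  by move=> iN; rewrite tE// y_sign.
have [c [mu [c0 _ tmu]]] := alternating_roots l_incr szt t_sign.
have q_sign i : (i <= n)%N -> 0 < (-1) ^+ (n - i) * (node_poly mu n).[l i].
  by move=> iN; rewrite -(pmulr_rgt0 _ c0) mulrCA -hornerZ -tmu t_sign.
have [a [b [u [[u0 b0 b1 aE] [Pp Pq _]]]]] :=
  jacobi_inverse (lam_gt0 _) l_incr (node_poly_monic mu n)
    (size_node_poly mu n) q_sign.
pose M := jacobi a b n.+1.
have GM : in_Gamma M.
  split; first exact: jacobi_shape.
  by apply/prodf_neq0 => k _; rewrite subdiag_jacobi gt_eqF// b1.
have GL : in_Gamma (map_mx (real_complex R) M) by apply/in_Gamma_complex.
have charL : char_poly (map_mx (real_complex R) M) = spec_poly lam.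
  exact/char_poly_complex.
pose L : isospectral lam := exist _ (map_mx (real_complex R) M) (conj GL charL).
exists L.
  by exists M => //; exact: jacobi_tnn u0 b0 aE.
(* [c^-1] comes from making the interpolant monic; the sign is the product of [(-1) ^+ n] from
   [Delta11_char_poly] and [(-1) ^+ n.+1] from [y]. *)
apply/jac_class_eq; exists (- c^-1)%:C => [|i /=].
  by rewrite fmorph_eq0 oppr_eq0 invr_eq0 gt_eqF.
rewrite Delta11_complex Fx -rmorphM; congr (_%:C).
have li : l i = lam i by rewrite /l inord_val.
rewrite Delta11_char_poly jacobi_minor Pq -li.
have qE : (node_poly mu n).[l i] = c^-1 * y i.
  by rewrite -tE// tmu hornerZ mulKf// gt_eqF.
rewrite qE /y inord_val exprS mulrCA mulN1r mulNr mulrN mulrA -expr2 sqrr_sign.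
by rewrite mul1r mulrN mulNr.
Qed.
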